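(* Let $G$ be a non-periodic group. Then the following hold: (i) $G$ is a BNI-group if and only if either $G$ is abelian or $G=\langle g,A\rangle$, where $A$ is a non-periodic abelian group of finite $0$-rank and finite $2$-rank, and $g$ is an element of order at most $4$ such that $g^2\in A$ and $a^g=a^{-1}$ for all $a\in A$. (ii) There exists a positive integer $n$ such that $|N_G(\langle x\rangle):\langle x\rangle|\le n$ for every $x\in G$ with $\langle x\rangle$ not normal in $G$, if and only if $G$ is a BCI-group.
   Context: A group is non-periodic if it has an element of infinite order. A group $G$ is a BCI-group if there exists a positive integer $n$ such that $|C_G(x):\langle x\rangle|\le n$ for every $x\in G$ such that $\langle x\rangle$ is not normal in $G$. A group $G$ is a BNI-group if there exists a positive integer $n$ such that $|N_G(H):H|\le n$ for every non-normal subgroup $H$ of $G$. For an abelian group $A$, the $0$-rank (torsion-free rank) of $A$ is the cardinality of a maximal independent subset of elements of $A$ of infinite order; for a prime $p$, the $p$-rank of $A$ is the dimension over the field with $p$ elements of the subgroup formed by the elements of $A$ of order at most $p$ in its Sylow $p$-subgroup $A_p$, i.e. of $\{a\in A \mid a^p=1\}$. The notation $a^g$ means $g^{-1}ag$. *)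

(* Defs.v *)
From mathcomp Require Import all_boot all_order all_algebra.
From mathcomp Require Import boolp classical_sets functions cardinality.

Set Implicit Arguments.
Unset Strict Implicit.
Unset Printing Implicit Defensive.

Local Open Scope classical_set_scope.
Local Open Scope card_scope.
Local Open Scope group_scope.

(* Groups are arbitrary, possibly infinite, instances of groupType; their
   subsets and subgroups are sets in the sense of classical_sets. *)

Definition is_subgroup (G : groupType) (H : set G) : Prop :=
  [/\ H 1, (forall x y, H x -> H y -> H (x * y)) & (forall x, H x -> H x^-1)].

Definition gen (G : groupType) (X : set G) : set G := smallest (@is_subgroup G) X.

Definition cyc (G : groupType) (x : G) : set G := gen [set x].

Definition conj_set (G : groupType) (H : set G) (g : G) : set G :=
  [set h ^ g | h in H].

(* Equality is required, not just inclusion: for infinite H, the inclusion of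
   conj_set H g in H does not imply equality. *)
Definition normaliser (G : groupType) (H : set G) : set G :=
  [set g | conj_set H g = H].

Definition is_normal (G : groupType) (H : set G) : Prop :=
  forall g : G, conj_set H g = H.

Definition centraliser (G : groupType) (x : G) : set G :=
  [set y | commute x y].

Definition abelian_set (G : groupType) (A : set G) : Prop :=
  forall x y : G, A x -> A y -> commute x y.

Definition right_cosets (G : groupType) (K H : set G) : set (set G) :=
  [set [set h * x | h in H] | x in K].

(* |K : H| <= n, for subgroups H of K. *)
Definition index_le (G : groupType) (K H : set G) (n : nat) : Prop :=
  right_cosets K H #<= `I_n.

Definition is_order (G : groupType) (x : G) (k : nat) : Prop :=
  [/\ (0 < k)%N, x ^+ k = 1 & forall j, (0 < j < k)%N -> x ^+ j <> 1].

Definition infinite_order (G : groupType) (x : G) : Prop :=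
  ~ exists k, is_order x k.

Definition non_periodic (G : groupType) (A : set G) : Prop :=
  exists2 x, A x & infinite_order x.

Definition BCI (G : groupType) : Prop :=
  exists2 n, (0 < n)%N &
    forall x : G, ~ is_normal (cyc x) -> index_le (centraliser x) (cyc x) n.

Definition BNI (G : groupType) : Prop :=
  exists2 n, (0 < n)%N &
    forall H : set G, is_subgroup H -> ~ is_normal H ->
      index_le (normaliser H) H n.

(* The rank notions below are meant for an abelian subgroup A, so that the
   products do not depend on the order of the factors. *)

Definition zexpg (G : groupType) (x : G) (m : int) : G :=
  match m with Posz n => x ^+ n | Negz n => x ^- n.+1 end.

Definition independent (G : groupType) (X : set G) : Prop :=
  ~ X 1 /\
  forall (s : seq G) (m : G -> int), uniq s -> (forall x, x \in s -> X x) ->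
    \prod_(x <- s) zexpg x (m x) = 1 ->
    forall x, x \in s -> zexpg x (m x) = 1.

Definition torsion_free_independent (G : groupType) (A X : set G) : Prop :=
  [/\ X `<=` A, (forall x, X x -> infinite_order x) & independent X].

Definition has_0rank (G : groupType) (A : set G) (r : nat) : Prop :=
  exists X : set G,
    [/\ torsion_free_independent A X,
        (forall Y, torsion_free_independent A Y -> X `<=` Y -> Y = X) &
        X #= `I_r].

Definition finite_0rank (G : groupType) (A : set G) : Prop :=
  exists r, has_0rank A r.

Definition p_socle (G : groupType) (p : nat) (A : set G) : set G :=
  [set a | A a /\ a ^+ p = 1].

(* X is a basis of p_socle p A over the field with p elements (p prime), where
   a scalar c acts as a |-> a ^+ c, c being coerced to its representative in
   0, ..., p - 1. *)
Definition p_socle_basis (G : groupType) (p : nat) (A X : set G) : Prop :=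
  [/\ X `<=` p_socle p A,
      (forall (s : seq G) (c : G -> 'F_p),
         uniq s -> (forall x, x \in s -> X x) ->
         \prod_(x <- s) x ^+ (c x : nat) = 1 ->
         forall x, x \in s -> c x = 0%R) &
      (forall a, p_socle p A a ->
         exists (s : seq G) (c : G -> 'F_p),
           [/\ uniq s, (forall x, x \in s -> X x) &
               a = \prod_(x <- s) x ^+ (c x : nat)])].

Definition has_prank (G : groupType) (p : nat) (A : set G) (r : nat) : Prop :=
  exists2 X : set G, p_socle_basis p A X & X #= `I_r.

Definition finite_prank (G : groupType) (p : nat) (A : set G) : Prop :=
  exists r, has_prank p A r.

(* Main.v *)
Require Import Defs.
From HB Require Import structures.
From mathcomp Require Import all_boot all_order all_algebra.
From mathcomp Require Import boolp classical_sets functions cardinality.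
From mathcomp Require Import zify.

Set Implicit Arguments.
Unset Strict Implicit.
Unset Printing Implicit Defensive.

Import GRing.Theory.

Local Open Scope classical_set_scope.
Local Open Scope card_scope.
Local Open Scope group_scope.

(** Boundedness of centralisers already determines [G] up to inversion.  Let [z]
    have infinite order.  The centraliser of [z ^+ k] contains [z], so its index
    over the subgroup generated by [z ^+ k] is at least [k]; for large [k] that
    subgroup is therefore normal, and comparing two consecutive exponents shows
    that the subgroup generated by [z] is normal too.  Hence each [g] maps [z] to
    [z] or [z^-1], and looking at products shows that the choice does not depend
    on [z] ([BCI_dichotomy]).  The centraliser [A] of all elements of infinite
    order is then abelian, of index at most 2, and inverted by every element
    outside it; such elements have order dividing 4 ([BCI_inverting]).

    For (ii), only the cyclic subgroups generated by some [x] outside [A] can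
    fail to be normal; then [x ^+ 4 = 1], so the normaliser exceeds the
    centraliser by a factor of at most 4 ([BCI_cyc_normaliser]).

    For (i), a subgroup of [A] is normal, and a subgroup [H] that contains an
    element outside [A] is normalised by [a] in [A] exactly when [a ^+ 2] lies in
    [H].  So the BNI condition is a uniform bound on the sections
    [{a | 2a in B} / B], with [B] the intersection of [H] and [A].  Applied to
    [B] of order at most 2 it bounds the 2-torsion of [A], and applied to a
    subgroup spanned by multiples of 4 it bounds the length of torsion-free
    independent lists ([BNI_finite_ranks]).  Conversely, if the two ranks are
    finite, let [F] be spanned by a maximal torsion-free independent set.  Every
    elementary abelian 2-section of [F] has order at most [2 ^ r], and those of
    the torsion group [A / F] are no larger than its 2-torsion, which is finite;
    combining both along [0 <= F <= A] gives the bound ([colourable_halving]).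

    Indices are counted by colourings: [|K : B| <= n] when [K] can be coloured
    with [n] colours so that elements of the same colour are congruent modulo
    [B]. *)

(** * Counting classes of a relation *)

(** [colourable K R n]: the set [K] can be coloured with [n] colours so that
    elements of the same colour are related by [R].  When [R] is an equivalence
    relation, this says that [K] meets at most [n] classes. *)
Definition colourable (T : Type) (K : set T) (R : T -> T -> Prop) (n : nat) :=
  exists c : T -> 'I_n, forall x y, K x -> K y -> c x = c y -> R x y.

(** [separated K R m]: there are [m] pairwise unrelated elements in [K]. *)
Definition separated (T : Type) (K : set T) (R : T -> T -> Prop) (m : nat) :=
  exists2 f : 'I_m -> T, forall i, K (f i) & forall i j, R (f i) (f j) -> i = j.

Lemma colourable_fin (T : Type) (F : finType) (K : set T) (R : T -> T -> Prop)
    (c : T -> F) :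
  (forall x y, K x -> K y -> c x = c y -> R x y) -> colourable K R #|F|.
Proof.
move=> h; exists (fun x => enum_rank (c x)) => x y Kx Ky /enum_rank_inj.
exact: h.
Qed.

Lemma separated_leq (T : Type) (K : set T) (R : T -> T -> Prop) m n :
  separated K R m -> colourable K R n -> (m <= n)%N.
Proof.
move=> [f Kf fR] [c cR].
have inj : injective (c \o f).
  by move=> i j /= e; apply: fR; apply: cR.
by have := leq_card _ inj; rewrite !card_ord.
Qed.

(** If no separated family has more than [n] members, then a largest one
    provides a colouring: an element gets the index of a member related to
    it. *)
Lemma exact_count (T : Type) (K : set T) (R : T -> T -> Prop) n :
  (forall x, K x -> R x x) -> (forall x y, R x y -> R y x) ->
  (forall x y z, R x y -> R y z -> R x z) -> (exists x, K x) ->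
  (forall m, separated K R m -> (m <= n)%N) ->
  exists m, [/\ separated K R m, colourable K R m & (0 < m <= n)%N].
Proof.
move=> Rxx Rs Rt [x0 Kx0] hn.
have ex0 : exists m, `[< separated K R m >].
  by exists 0%N; apply/asboolP; exists (fun=> x0) => // -[].
have hb m : `[< separated K R m >] -> (m <= n)%N by move=> /asboolP /hn.
case: (ex_maxnP ex0 hb) => m /asboolP hm maxm.
have m0 : (0 < m)%N.
  apply: maxm; apply/asboolP; exists (fun=> x0) => // i j _.
  by rewrite !ord1.
have hmn := hn _ hm.
exists m; split=> //; last by rewrite m0.
case: hm => f Kf fR.
have near x : exists i, K x -> R x (f i).
  case: (pselect (exists i, R x (f i))) => [[i hi]|no]; first by exists i.
  exists (Ordinal m0) => Kx; exfalso.
  suff /maxm : `[< separated K R m.+1 >] by rewrite ltnn.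
  apply/asboolP.
  exists (fun i => if unlift ord_max i is Some j then f j else x).
    by move=> i; case: unliftP.
  move=> i j; case: unliftP => [i'|] ->; case: unliftP => [j'|] -> //.
  - by move=> /fR ->.
  - by move=> /Rs h; case: no; exists i'.
  - by move=> h; case: no; exists j'.
have [c hc] := choice near.
exists c => x y Kx Ky e; apply: (Rt _ (f (c x))); first exact: hc.
by apply: Rs; rewrite e; apply: hc.
Qed.

(** Multiplicativity of the index: if [K] meets at most [m] classes of [R1], each
    of which meets at most [n] classes of [R2], then [K] meets at most [m * n]
    classes of [R2]. *)
Lemma colourable_trans (T : Type) (K : set T) (R1 R2 : T -> T -> Prop) m n :
  (exists x, K x) -> colourable K R1 m ->
  (forall r, K r -> colourable [set x | K x /\ R1 x r] R2 n) ->
  colourable K R2 (m * n).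
Proof.
move=> [x0 Kx0] [c1 h1] h2.
have [rep hrep] : exists rep : 'I_m -> T,
    forall x, K x -> K (rep (c1 x)) /\ c1 (rep (c1 x)) = c1 x.
  have hc i : exists r, forall x, K x -> c1 x = i -> K r /\ c1 r = i.
    have [[r hr]|no] := pselect (exists r, K r /\ c1 r = i).
      by exists r.
    by exists x0 => x Kx e; case: no; exists x.
  have [rep hr] := choice hc.
  by exists rep => x Kx; apply: (hr _ x).
have hr i : exists c2 : T -> 'I_n, K (rep i) ->
    forall x y, K x -> K y -> R1 x (rep i) -> R1 y (rep i) ->
    c2 x = c2 y -> R2 x y.
  have [Ki|nKi] := pselect (K (rep i)).
    by have [c2 hc2] := h2 _ Ki; exists c2 => _ x y *; apply: hc2.
  by have [c2 _] := h2 _ Kx0; exists c2.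
have [c2 hc2] := choice hr.
have <- : #|{: 'I_m * 'I_n}| = (m * n)%N by rewrite card_prod !card_ord.
apply: (colourable_fin (c := fun x => (c1 x, c2 (c1 x) x))).
move=> x y Kx Ky [e1 e2].
have [Kr er] := hrep _ Kx.
apply: (hc2 (c1 x)) => //; last by rewrite e2 e1.
- by apply: h1.
- by apply: h1 => //; rewrite er.
Qed.

Lemma colourable_sub (T : Type) (K K' : set T) (R : T -> T -> Prop) n :
  K `<=` K' -> colourable K' R n -> colourable K R n.
Proof. by move=> sK [c hc]; exists c => x y /sK Kx /sK Ky; apply: hc. Qed.

(** * Elementary abelian sections of an abelian group *)

Section Zmod.
Variable V : zmodType.
Implicit Types (B C D E F K : set V) (x y z : V).
Local Open Scope ring_scope.

Lemma subr_split x y a b : x - y = x - a - (y - b) + (a - b).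
Proof. by rewrite [RHS]addrA [_ - _ + a]addrAC subrK -addrA -opprD subrK. Qed.

(** Subgroups of [V]. *)
Definition zsub B := B 0 /\ forall x y, B x -> B y -> B (x - y).

Lemma zsubN B x : zsub B -> B x -> B (- x).
Proof. by move=> [B0 BB] Bx; rewrite -sub0r; apply: BB. Qed.

Lemma zsubD B x y : zsub B -> B x -> B y -> B (x + y).
Proof.
by move=> sB Bx By; rewrite -[y]opprK; apply: sB.2 => //; apply: zsubN.
Qed.

Lemma zsubMn B x n : zsub B -> B x -> B (x *+ n).
Proof.
move=> sB Bx; elim: n => [|n IH]; first by rewrite mulr0n; case: sB.
by rewrite mulrS; apply: zsubD.
Qed.

Lemma zsubMz B x (m : int) : zsub B -> B x -> B (x *~ m).
Proof.
by move=> sB Bx; case: m => n; [apply: zsubMn|apply: (zsubN sB); apply: zsubMn].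
Qed.

Lemma zsub_sum B (s : seq V) (f : V -> V) :
  zsub B -> (forall x, x \in s -> B (f x)) -> B (\sum_(x <- s) f x).
Proof.
move=> sB h; rewrite big_seq; elim/big_ind: _ => //; first by case: sB.
by move=> x y; apply: zsubD.
Qed.

(** The relation of lying in the same coset of [B]. *)
Definition eqmod B x y := B (x - y).

Lemma eqmod_refl B x : zsub B -> eqmod B x x.
Proof. by move=> [B0 _]; rewrite /eqmod subrr. Qed.

Lemma eqmod_sym B x y : zsub B -> eqmod B x y -> eqmod B y x.
Proof. by move=> sB; rewrite /eqmod -[y - x]opprB; apply: zsubN. Qed.

Lemma eqmod_trans B x y z :
  zsub B -> eqmod B x y -> eqmod B y z -> eqmod B x z.
Proof.
by move=> sB h1 h2; rewrite /eqmod -(subrKA y); apply: zsubD.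
Qed.

(** [elem_bounded C D n]: every section [K / B] of exponent dividing 2 with
    [C <= B <= K <= D] has order at most [n]. *)
Definition elem_bounded C D (n : nat) :=
  forall K B, zsub K -> zsub B -> C `<=` B -> B `<=` K -> K `<=` D ->
    (forall x, K x -> B (x *+ 2)) -> colourable K (eqmod B) n.

(** The sum [B + C] of two subgroups. *)
Definition sumset B C : set V := [set z | exists x y, [/\ B x, C y & z = x + y]].

Lemma zsub_sumset B C : zsub B -> zsub C -> zsub (sumset B C).
Proof.
move=> sB sC; split; first by exists 0, 0; split; [case: sB|case: sC|rewrite addr0].
move=> _ _ [x [y [Bx Cy ->]]] [x' [y' [Bx' Cy' ->]]].
by exists (x - x'), (y - y'); split; [apply: sB.2|apply: sC.2|rewrite opprD addrACA].
Qed.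

Lemma sumsetl B C : zsub C -> B `<=` sumset B C.
Proof. by move=> [C0 _] x Bx; exists x, 0; rewrite addr0. Qed.

Lemma sumsetr B C : zsub B -> C `<=` sumset B C.
Proof. by move=> [B0 _] x Bx; exists 0, x; rewrite add0r. Qed.

Lemma zsubI B C : zsub B -> zsub C -> zsub (B `&` C).
Proof.
move=> sB sC; split; first by split; [case: sB|case: sC].
by move=> x y [Bx Cx] [By Cy]; split; [apply: sB.2|apply: sC.2].
Qed.

(** Boundedness of elementary abelian sections is closed under extensions. *)
Lemma elem_bounded_ext C D E m n :
  zsub D -> zsub E -> D `<=` E -> C `<=` D ->
  elem_bounded C D n -> elem_bounded D E m -> elem_bounded C E (m * n).
Proof.
move=> sD sE DE CD hn hm K B sK sB CB BK KE K2.
have c1 : colourable (sumset K D) (eqmod (sumset B D)) m.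
  apply: hm; [exact: zsub_sumset|exact: zsub_sumset|exact: sumsetr| | |].
  - by move=> _ [x [y [/BK Kx Dy ->]]]; exists x, y.
  - by move=> _ [x [y [/KE Kx /DE Dy ->]]]; apply: zsubD.
  - move=> _ [x [y [Kx Dy ->]]]; exists (x *+ 2), (y *+ 2).
    by rewrite mulrnDl; split=> //; [exact: K2|exact: zsubMn].
have [c2 hc2] : colourable (K `&` D) (eqmod (B `&` D)) n.
  apply: hn; [exact: zsubI|exact: zsubI| | | |].
  - by move=> x Cx; split; [exact: CB|exact: CD].
  - by move=> x [/BK].
  - by move=> x [].
  - by move=> x [Kx Dx]; split; [exact: K2|exact: zsubMn].
have [K0 _] := sK.
apply: (colourable_trans _ (colourable_sub (sumsetl sD) c1)); first by exists 0.
move=> r Kr.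
have /choice [d hd] x : exists d, K x -> sumset B D (x - r) ->
    [/\ K d, D d & B (x - r - d)].
  have [[y [d [By Dd e]]]|no] := pselect (sumset B D (x - r)); last by exists 0.
  exists d => Kx _; split=> //; last by rewrite e addrK.
  rewrite (_ : d = (x - r) - y); last by rewrite e addrC addKr.
  by apply: sK.2; [apply: sK.2|exact: BK].
exists (fun x => c2 (d x)) => x y [Kx hx] [Ky hy] e.
have [Kdx Ddx Bx] := hd _ Kx hx; have [Kdy Ddy By] := hd _ Ky hy.
have [Bxy _] := hc2 _ _ (conj Kdx Ddx) (conj Kdy Ddy) e.
rewrite /eqmod -(subrKA r) -[r - y]opprB.
rewrite (subr_split (x - r) (y - r) (d x) (d y)).
by apply: zsubD => //; apply: sB.2.
Qed.

(** An exponent-2 section of a cyclic extension has order at most 2: if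
    [i * x] and [j * x] lie in [K] but not in [B], then with [e = gcd(i, j)]
    both [i / e] and [j / e] are odd, so [i - j] is an even multiple of
    [e]. *)
Lemma elem_bounded_cyclic C x :
  zsub C -> elem_bounded C [set y | exists m : int, C (y - x *~ m)] 2.
Proof.
move=> sC K B sK sB CB BK KD K2.
have <- : #|{: bool}| = 2%N by rewrite card_bool.
apply: (colourable_fin (c := fun y => `[< B y >])) => y z Ky Kz e.
have [By|nBy] := pselect (B y).
  have Bz : B z by apply/asboolP; rewrite -e; apply/asboolP.
  exact: sB.2.
have nBz : ~ B z by move=> /asboolP; rewrite -e => /asboolP.
have [i Ci] := KD _ Ky; have [j Cj] := KD _ Kz.
have KC u : C u -> K u by move=> /CB /BK.
have Ki : K (x *~ i) by rewrite -[x *~ i](subKr y); apply: sK.2 => //; apply: KC.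
have Kj : K (x *~ j) by rewrite -[x *~ j](subKr z); apply: sK.2 => //; apply: KC.
have [u [v bez]] := Bezoutz i j.
have Ke : K (x *~ gcdz i j).
  by rewrite -bez mulrzDr [u * _]mulrC [v * _]mulrC !mulrzA; apply: zsubD => //; apply: zsubMz.
have Beven (k : int) : B (x *~ (gcdz i j * 2 * k)).
  by rewrite !mulrzA; apply: zsubMz => //; apply: K2.
have odd_quo (l : int) w : (gcdz i j %| l)%Z -> C (w - x *~ l) -> ~ B w ->
    exists k, l = gcdz i j * (2 * k + 1).
  move=> /dvdzP[q ->] Cw nBw.
  have [k [ek|ek]] : exists k : int, q = 2 * k \/ q = 2 * k + 1.
    by exists (q %/ 2)%Z; lia.
    case: nBw; rewrite -(subrK (x *~ (q * gcdz i j)) w).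
    by apply: zsubD; [|exact: CB|rewrite ek mulrC mulrA].
  by exists k; rewrite mulrC ek.
have [k ek] := odd_quo _ _ (dvdz_gcdl i j) Ci nBy.
have [l el] := odd_quo _ _ (dvdz_gcdr i j) Cj nBz.
rewrite /eqmod.
rewrite (subr_split y z (x *~ i) (x *~ j)) -mulrzBr.
apply: zsubD => //; first by apply: sB.2; apply: CB.
have -> : i - j = gcdz i j * 2 * (k - l) 
  by move: (gcdz i j) ek el => e' -> ->; lia.
exact: Beven.
Qed.

(** The subgroup of integral linear combinations of the members of a list. *)
Fixpoint zspan (s : seq V) : set V :=
  if s is x :: s' then [set y | exists m : int, zspan s' (y - x *~ m)]
  else [set 0].

Lemma zsub_zspan s : zsub (zspan s).
Proof.
elim: s => [|x s IH]; first by split=> // _ _ -> ->; rewrite subrr.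
split; first by exists 0; rewrite mulr0z subrr; case: IH.
move=> y z [m hy] [m' hz]; exists (m - m').
rewrite mulrzBr (subr_split y z (x *~ m) (x *~ m')) addrK.
exact: IH.2.
Qed.

Lemma zspan_cons x s : zspan s `<=` zspan (x :: s).
Proof. by move=> y hy; exists 0; rewrite mulr0z subr0. Qed.

Lemma zspan_mem s x : x \in s -> zspan s x.
Proof.
elim: s => // y s IH; rewrite inE => /orP[/eqP ->|/IH].
  by exists 1; rewrite mulr1z subrr; case: (zsub_zspan s).
exact: zspan_cons.
Qed.

Lemma elem_bounded_zspan s : elem_bounded [set 0] (zspan s) (2 ^ size s).
Proof.
elim: s => [|x s IH].
  move=> K B sK sB CB BK K0 _; exists (fun=> ord0) => x y /K0 -> /K0 -> _.
  exact: eqmod_refl.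
rewrite /= expnS; apply: elem_bounded_ext IH (elem_bounded_cyclic (zsub_zspan s)).
- exact: zsub_zspan.
- exact: (zsub_zspan (x :: s)).
- exact: zspan_cons.
- by move=> _ ->; case: (zsub_zspan s).
Qed.

(** The subgroup [2B]. *)
Definition dbl B : set V := [set x *+ 2 | x in B].

Lemma zsub_dbl B : zsub B -> zsub (dbl B).
Proof.
move=> sB; split; first by exists 0; rewrite ?mul0rn //; case: sB.
by move=> _ _ [x Bx <-] [y By <-]; exists (x - y); [exact: sB.2|rewrite mulrnBl].
Qed.

(** The 2-torsion of [V / F] is finite when [F / 2F] and the 2-torsion of [V]
    are. *)
Lemma colourable_two_torsion F n q :
  zsub F -> colourable F (eqmod (dbl F)) n ->
  colourable [set x : V | x *+ 2 = 0] eq q ->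
  colourable [set x | F (x *+ 2)] (eqmod F) (n * q).
Proof.
move=> sF [c1 h1] [c2 h2].
apply: (@colourable_trans _ _ (fun x y => eqmod (dbl F) (x *+ 2) (y *+ 2))).
- by exists 0; rewrite /= mul0rn; case: sF.
- by exists (fun x => c1 (x *+ 2)) => x y Fx Fy; apply: h1.
move=> r Fr.
have /choice [f hf] x : exists f, eqmod (dbl F) (x *+ 2) (r *+ 2) ->
    F f /\ (x - r - f) *+ 2 = 0.
  have [[f Ff e]|no] := pselect (eqmod (dbl F) (x *+ 2) (r *+ 2)); last by exists 0.
  by exists f => _; split=> //; rewrite !mulrnBl e subrr.
exists (fun x => c2 (x - r - f x)) => x y [_ /hf[Fx x0]] [_ /hf[Fy y0]] e.
have {}e := h2 _ _ x0 y0 e.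
rewrite /eqmod -(subrKA r) -[r - y]opprB (subr_split (x - r) (y - r) (f x) (f y)).
by rewrite e subrr add0r; apply: sF.2.
Qed.

(** Iterating doubling, the [2 ^ c]-torsion of [V / F] is finite as soon as the
    2-torsion is. *)
Lemma colourable_torsion F q c :
  zsub F -> colourable [set x | F (x *+ 2)] (eqmod F) q ->
  colourable [set x | F (x *+ 2 ^ c)] (eqmod F) (q ^ c).
Proof.
move=> sF [c1 h1]; elim: c => [|c [c2 h2]].
  by exists (fun=> ord0) => x y; rewrite /= !mulr1n => Fx Fy _; apply: sF.2.
rewrite [(q ^ _)%N]expnSr.
apply: (@colourable_trans _ _ (fun x y => eqmod F (x *+ 2) (y *+ 2))).
- by exists 0; rewrite /= mul0rn; case: sF.
- exists (fun x => c2 (x *+ 2)) => x y Fx Fy; apply: h2;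
    by rewrite /= -mulrnA -expnS.
move=> r Fr; exists (fun x => c1 (x - r)) => x y [_ hx] [_ hy] e.
rewrite /eqmod -(subrKA r) -[r - y]opprB; apply: h1 => //=.
  by rewrite mulrnBl.
by rewrite mulrnBl.
Qed.

(** The elementary abelian quotients of a finite abelian group [W] are no
    larger than its 2-torsion subgroup [W[2]], because [|W : 2W| = |W[2]|].
    In a torsion group [V / F] the claim follows: given [m] elements of [K]
    distinct modulo [B], odd multiples of them lie in [W = U / F], where [U]
    consists of the [x] in [K] with [2 ^ c * x] in [F]; with
    [b = |2U + F : F|], [m * b <= |U : F| <= b * q]. *)
Lemma elem_bounded_torsion F q :
  zsub F -> (forall x, exists2 k, (0 < k)%N & F (x *+ k)) ->
  colourable [set x | F (x *+ 2)] (eqmod F) q ->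
  elem_bounded F [set: V] q.
Proof.
move=> sF tors hq K B sK sB FB BK _ K2.
have FK : F `<=` K by move=> x /FB /BK.
suff hm m : separated K (eqmod B) m -> (m <= q)%N.
  have [||||m [_ hm1 /andP[_ hm2]]] := @exact_count _ K (eqmod B) q _ _ _ _ hm.
  - by move=> x _; apply: eqmod_refl.
  - by move=> x y; apply: eqmod_sym.
  - by move=> x y z; apply: eqmod_trans.
  - by exists 0; case: sK.
  case: hm1 => c hc; exists (fun x => widen_ord hm2 (c x)) => x y Kx Ky e.
  by apply: hc => //; apply: val_inj; exact: (congr1 val e).
move=> [f Kf fB].
have [c hc] : exists c, forall i : 'I_m, exists2 o, odd o & F (f i *+ o *+ 2 ^ c).
  have /choice [k hk] i : exists k, (0 < k)%N /\ F (f i *+ k).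
    by have [k k0 Fk] := tors (f i); exists k.
  (* The odd part of [k i] serves as odd multiplier, and a sum of 2-adic
     valuations bounds each of them. *)
  exists (\sum_(i < m) logn 2 (k i))%N => i.
  have [k0 Fk] := hk i.
  exists ((k i)`_2^')%N; first by rewrite odd_2'nat part_pnat.
  rewrite -mulrnA (bigD1 i) //= expnD -[(2 ^ logn _ _)%N]p_part mulnA.
  by rewrite [(_ * _`_2)%N]mulnC partnC // mulrnA; apply: zsubMn.
pose U := [set x | K x /\ F (x *+ 2 ^ c)].
have sU : zsub U.
  split; first by split; [case: sK|rewrite mul0rn; case: sF].
  by move=> x y [Kx Fx] [Ky Fy]; split; [exact: sK.2|rewrite mulrnBl; exact: sF.2].
have FU : F `<=` U by move=> x Fx; split; [exact: FK|exact: zsubMn].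
pose W := sumset (dbl U) F.
have sW : zsub W by apply: zsub_sumset => //; apply: zsub_dbl.
have WU : W `<=` U.
  move=> _ [_ [x [[y Uy <-] Fx ->]]]; apply: zsubD => //; last exact: FU.
  exact: zsubMn.
have WB : W `<=` B.
  move=> _ [_ [x [[y [Ky _] <-] Fx ->]]]; apply: zsubD => //; last exact: FB.
  exact: K2.
have colU : colourable U (eqmod F) (q ^ c).
  by apply: colourable_sub (colourable_torsion c sF hq) => x [].
have [|||||a [sepa cola _]] := @exact_count _ U (eqmod F) (q ^ c).
- by move=> x _; apply: eqmod_refl.
- by move=> x y; apply: eqmod_sym.
- by move=> x y z; apply: eqmod_trans.
- by exists 0; case: sU.
- by move=> k hk; apply: separated_leq hk colU.
have [|||||b [sepb colb /andP[b0 _]]] := @exact_count _ W (eqmod F) (q ^ c).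
- by move=> x _; apply: eqmod_refl.
- by move=> x y; apply: eqmod_sym.
- by move=> x y z; apply: eqmod_trans.
- by exists 0; case: sW.
- by move=> k hk; apply: separated_leq hk (colourable_sub WU colU).
(* Doubling sends [U] to [W] with kernel the 2-torsion modulo [F]. *)
have hab : (a <= b * q)%N.
  apply: separated_leq sepa _.
  apply: (@colourable_trans _ _ (fun x y => eqmod F (x *+ 2) (y *+ 2))).
  - by exists 0; case: sU.
  - case: colb => cb hb; exists (fun x => cb (x *+ 2)) => x y Ux Uy.
    by apply: hb; apply: sumsetl => //; [exists x|exists y].
  case: hq => c1 h1 r Ur; exists (fun x => c1 (x - r)) => x y [_ hx] [_ hy] e.
  rewrite /eqmod -(subrKA r) -[r - y]opprB; apply: h1 => //=.
    by rewrite mulrnBl.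
  by rewrite mulrnBl.
(* The sums of an odd multiple of some [f i] and a representative of [W / F]
   are distinct modulo [F]. *)
have hmb : (m * b <= a)%N.
  apply: separated_leq cola.
  case: sepb => g Wg gF.
  have /choice [o ho] i : exists o, odd o /\ F (f i *+ o *+ 2 ^ c).
    by have [o] := hc i; exists o.
  rewrite -[m]card_ord -[b]card_ord -card_prod.
  have sep (I : finType) (h : I -> V) : (forall i, U (h i)) ->
      (forall i j, eqmod F (h i) (h j) -> i = j) -> separated U (eqmod F) #|I|.
    move=> h1 h2; exists (fun i => h (enum_val i)) => // i j /h2.
    exact: enum_val_inj.
  apply: (sep _ (fun p => f p.1 *+ o p.1 + g p.2)).
    move=> [i j] /=; apply: zsubD => //; last exact: WU.
    by split; [exact: zsubMn|case: (ho i)].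
  move=> [i j] [i' j'] /=; rewrite /eqmod opprD addrACA => h.
  have ei : i = i'.
    apply: fB.
    have odd_mod k : eqmod B (f k) (f k *+ o k).
      have [ok _] := ho k; rewrite -[X in f k *+ X]odd_double_half ok add1n.
      rewrite mulrS /eqmod opprD addNKr -mul2n mulrnA.
      by apply: (zsubN sB); apply: (zsubMn _ sB); apply: K2.
    apply: eqmod_trans (odd_mod i) _ => //.
    apply: eqmod_trans (eqmod_sym _ (odd_mod i')) => //.
    rewrite /eqmod -[X in B X](addrK (g j - g j')).
    exact: (sB.2 _ _ (FB _ h) (sB.2 _ _ (WB _ (Wg j)) (WB _ (Wg j')))).
  by move: h; rewrite ei subrr add0r => /gF ->.
by have := leq_trans hmb hab; rewrite mulnC leq_pmul2l.
Qed.

End Zmod.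

(** The bound on [|K : B|] for [K = {x | 2x in B}], uniform in [B], by filtering
    [0 <= F <= V] with [F] spanned by [s] and [V / F] torsion. *)
Lemma colourable_halving (V : zmodType) (s : seq V) q :
  (forall x, exists2 k, (0 < k)%N & zspan s (x *+ k)%R) ->
  colourable [set x : V | x *+ 2 = 0]%R eq q ->
  exists n, forall B, zsub B ->
    colourable [set x : V | B (x *+ 2)%R] (eqmod B) n.
Proof.
move=> tors soc; have sF := zsub_zspan s.
have sT : zsub [set: V] by [].
have F0 : [set 0%R] `<=` zspan s by move=> _ ->; case: sF.
have F2 : colourable (zspan s) (eqmod (dbl (zspan s))) (2 ^ size s).
  apply: elem_bounded_zspan => //; first exact: zsub_dbl.
  - by move=> _ ->; case: (zsub_dbl sF).
  - by move=> _ [x Fx <-]; apply: zsubMn.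
  - by move=> x Fx; exists x.
have tor := elem_bounded_torsion sF tors (colourable_two_torsion sF F2 soc).
have ext := elem_bounded_ext sF sT (@subsetT _ _) F0 (@elem_bounded_zspan V s) tor.
exists (2 ^ size s * q * 2 ^ size s)%N => B sB.
have sK : zsub [set x : V | B (x *+ 2)%R].
  split; first by rewrite /= mul0rn; case: sB.
  by move=> x y /= hx hy; rewrite mulrnBl; apply: sB.2.
apply: ext => //; first by move=> _ ->; case: sB.
by move=> x Bx; apply: zsubMn.
Qed.

Lemma card_seq (T : choiceType) (s : seq T) : uniq s -> [set` s] #= `I_(size s).
Proof.
move=> us; apply/card_set_bijP; exists (index^~ s); split.
- by move=> x /=; rewrite index_mem.
- by move=> x y /set_mem /= xs /set_mem ys; apply: index_inj.
- case: s us => [|x0 s] us i //= hi; exists (nth x0 (x0 :: s) i).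
    exact: mem_nth.
  exact: (@index_uniq _ x0 i (x0 :: s)) hi us.
Qed.

(** * Abelian subgroups as Z-modules *)

(** The abelian subgroup [A], written additively; the two proofs only serve to
    attach the [zmodType] structure to the subtype. *)
Definition abz (G : groupType) (A : set G) (hA : is_subgroup A)
  (cA : abelian_set A) : Type := {x : G | `[< A x >]}.

Section Abz.
Variables (G : groupType) (A : set G) (hA : is_subgroup A) (cA : abelian_set A).
Local Notation V := (abz hA cA).

HB.instance Definition _ := Choice.on V.

(** The inclusion of [A] in [G], and its partial inverse. *)
Definition abz_val (u : V) : G := \val u.
Definition abz_sub x (Ax : A x) : V := exist _ x (asboolT Ax).

Lemma abz_valP u : A (abz_val u). Proof. exact/asboolP/(valP u). Qed.

Lemma abz_val_inj : injective abz_val. Proof. exact: val_inj. Qed.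

Definition abz_zero : V := let: And3 A1 _ _ := hA in abz_sub A1.
Definition abz_add (u v : V) : V :=
  let: And3 _ AM _ := hA in abz_sub (AM _ _ (abz_valP u) (abz_valP v)).
Definition abz_opp (u : V) : V :=
  let: And3 _ _ AV := hA in abz_sub (AV _ (abz_valP u)).

Lemma abz_zeroE : abz_val abz_zero = 1.
Proof. by rewrite /abz_zero; case: hA. Qed.
Lemma abz_addE u v : abz_val (abz_add u v) = abz_val u * abz_val v.
Proof. by rewrite /abz_add; case: hA. Qed.
Lemma abz_oppE u : abz_val (abz_opp u) = (abz_val u)^-1.
Proof. by rewrite /abz_opp; case: hA. Qed.

Fact abz_addA : associative abz_add.
Proof. by move=> u v w; apply: abz_val_inj; rewrite !abz_addE mulgA. Qed.
Fact abz_addC : commutative abz_add.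
Proof.
by move=> u v; apply: abz_val_inj; rewrite !abz_addE; apply: cA; apply: abz_valP.
Qed.
Fact abz_add0 : left_id abz_zero abz_add.
Proof. by move=> u; apply: abz_val_inj; rewrite abz_addE abz_zeroE mul1g. Qed.
Fact abz_addN : left_inverse abz_zero abz_opp abz_add.
Proof.
by move=> u; apply: abz_val_inj; rewrite abz_addE abz_zeroE abz_oppE mulVg.
Qed.

HB.instance Definition _ :=
  GRing.isZmodule.Build V abz_addA abz_addC abz_add0 abz_addN.

Lemma abz_val0 : abz_val 0%R = 1. Proof. exact: abz_zeroE. Qed.

Lemma abz_valD (u v : V) : abz_val (u + v)%R = abz_val u * abz_val v.
Proof. exact: abz_addE. Qed.

Lemma abz_valN (u : V) : abz_val (- u)%R = (abz_val u)^-1.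
Proof. exact: abz_oppE. Qed.

Lemma abz_valMn (u : V) n : abz_val (u *+ n)%R = abz_val u ^+ n.
Proof.
elim: n => [|n IH]; first by rewrite mulr0n abz_val0.
by rewrite mulrS expgS abz_valD IH.
Qed.

Lemma abz_valMz (u : V) (m : int) : abz_val (u *~ m)%R = zexpg (abz_val u) m.
Proof.
by case: m => n /=; [exact: abz_valMn|rewrite -abz_valMn -abz_valN].
Qed.

Lemma abz_val_sum (s : seq V) (f : V -> V) :
  abz_val (\sum_(u <- s) f u)%R = \prod_(u <- s) abz_val (f u).
Proof. by apply: big_morph; [exact: abz_valD|exact: abz_val0]. Qed.

Lemma abz_val_eq1 (u : V) : abz_val u = 1 -> u = 0%R.
Proof. by move=> e; apply: abz_val_inj; rewrite e abz_val0. Qed.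

Lemma abz_surj x : A x -> exists u : V, abz_val u = x.
Proof. by move=> Ax; exists (abz_sub Ax). Qed.

Lemma abz_lift_seq (s : seq G) :
  (forall x, x \in s -> A x) -> exists t : seq V, map abz_val t = s.
Proof.
elim: s => [|x s IH] h; first by exists [::].
have [t et] : exists t, map abz_val t = s.
  by apply: IH => y ys; apply: h; rewrite inE ys orbT.
have [u eu] := abz_surj (h x (mem_head _ _)).
by exists (u :: t); rewrite /= et eu.
Qed.

Lemma abz_lift_fun (T : Type) (t0 : T) (c : V -> T) :
  exists c' : G -> T, forall u, c' (abz_val u) = c u.
Proof.
exists (fun x => if insub x is Some u then c (u : V) else t0) => u.
by rewrite /abz_val valK.
Qed.
End Abz.

(** * Finite ranks in additive terms *)

(** A sum over part of a list is a sum over the whole list with zero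
    coefficients elsewhere. *)
Lemma big_seq_extend (V : zmodType) (s t : seq V) (F : V -> V) :
  uniq s -> uniq t -> {subset s <= t} ->
  (\sum_(u <- s) F u = \sum_(u <- t) (if u \in s then F u else 0))%R.
Proof.
move=> us ut st; rewrite -big_mkcond -big_filter; apply: perm_big.
apply: uniq_perm => //; first exact: filter_uniq.
move=> u; rewrite mem_filter; case us': (u \in s) => //=.
by rewrite st.
Qed.

(** A property of lists that bounds their size has a longest witness. *)
Lemma max_seq (T : Type) (P : seq T -> Prop) n :
  P [::] -> (forall s, P s -> (size s <= n)%N) ->
  exists2 s, P s & forall s', P s' -> (size s' <= size s)%N.
Proof.
move=> P0 hn.
have ex0 : exists m, `[< exists2 s, P s & size s = m >].
  by exists 0%N; apply/asboolP; exists [::].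
have hb m : `[< exists2 s, P s & size s = m >] -> (m <= n)%N.
  by move=> /asboolP[s /hn h <-].
case: (ex_maxnP ex0 hb) => m /asboolP[s Ps <-] hm; exists s => // s' Ps'.
by apply: hm; apply/asboolP; exists s'.
Qed.

Lemma order_exists (G : groupType) (x : G) n :
  (0 < n)%N -> x ^+ n = 1 -> exists2 k, is_order x k & (k <= n)%N.
Proof.
move=> n0 en; have ex0 : exists k, (0 < k)%N && (x ^+ k == 1).
  by exists n; rewrite n0 en eqxx.
case: (ex_minnP ex0) => m /andP[m0 /eqP em] hm; exists m; last first.
  by apply: hm; rewrite n0 en eqxx.
split=> // j /andP[j0 jm] ej; have := hm j; rewrite j0 ej eqxx => /(_ isT).
by rewrite leqNgt jm.
Qed.

Lemma infinite_orderP (G : groupType) (x : G) :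
  infinite_order x <-> forall k, (0 < k)%N -> x ^+ k <> 1.
Proof.
split=> [h k k0 e|h [k [k0 e _]]]; last exact: h e.
by have [j oj _] := order_exists k0 e; apply: h; exists j.
Qed.

Section Ranks.
Variables (G : groupType) (A : set G) (hA : is_subgroup A) (cA : abelian_set A).
Local Notation V := (abz hA cA).
Local Notation val := (@abz_val G A hA cA).

Lemma abz_infinite (u : V) :
  infinite_order (val u) -> forall k, (0 < k)%N -> (u *+ k != 0)%R.
Proof.
move=> /infinite_orderP h k k0; apply/eqP => e; apply: (h k k0).
by rewrite -abz_valMn e abz_val0.
Qed.

Lemma abz_infinite_mulrz (u : V) (m : int) :
  infinite_order (val u) -> (u *~ m = 0)%R -> m = 0%R.
Proof.
move=> h; case: m => [[|n]|n] //= e.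
  by case/eqP: (abz_infinite h (ltn0Sn n)); exact: e.
by case/eqP: (abz_infinite h (ltn0Sn n)); apply: oppr_inj; rewrite oppr0; exact: e.
Qed.

(** Integral linear independence of the members of a list. *)
Definition zfree (t : seq V) := uniq t /\
  forall m : V -> int, (\sum_(u <- t) u *~ m u = 0)%R ->
    forall u, u \in t -> (u *~ m u = 0)%R.

Lemma independent_zfree (X : set G) (t : seq V) :
  independent X -> uniq t -> (forall u, u \in t -> X (val u)) -> zfree t.
Proof.
move=> [_ iX] ut tX; split=> // m sum0 u ut'.
have [m' hm'] := abz_lift_fun (0%R : int) m.
apply: abz_val_eq1; rewrite abz_valMz -hm'.
apply: (iX (map val t)) (map_f val ut').
- by rewrite map_inj_uniq //; apply: abz_val_inj.
- by move=> _ /mapP[w wt ->]; apply: tX.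
- rewrite big_map -[RHS](abz_val0 hA cA) -sum0 abz_val_sum; apply: eq_bigr => w _.
  by rewrite hm' abz_valMz.
Qed.

Lemma zfree_independent (t : seq V) :
  zfree t -> 0%R \notin t -> independent [set` map val t].
Proof.
move=> [ut ft] t0; split=> [/= /mapP[u ut' e]|s m us st prod1 x xs].
  by move/esym/abz_val_eq1: e ut' t0 => -> ->.
have [t' et'] : exists t' : seq V, map val t' = s.
  by apply: abz_lift_seq => y /st /= /mapP[u _ ->]; apply: abz_valP.
have ut' : uniq t' by rewrite -(map_inj_uniq (@abz_val_inj _ _ hA cA)) et'.
have tt' : {subset t' <= t}.
  move=> u u't; have /st /= /mapP[w wt /abz_val_inj ->] // : val u \in s.
  by rewrite -et'; apply: map_f.
move: xs; rewrite -{1}et' => /mapP[u u't ->].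
have := ft (fun u => if u \in t' then m (val u) else 0%R) _ u (tt' _ u't).
rewrite u't => h; rewrite -abz_valMz h ?abz_val0 //.
under eq_bigr => w _ do rewrite (fun_if (fun k => w *~ k)%R) mulr0z.
rewrite -(big_seq_extend (fun w => w *~ m (val w))%R) //.
apply: abz_val_eq1; rewrite abz_val_sum -[RHS]prod1 -et' big_map.
by apply: eq_bigr => w _; rewrite abz_valMz.
Qed.

(** A maximal torsion-free independent set spans [A] up to torsion: adding
    [val v] to it gives a relation in which [v] has a nonzero coefficient. *)
Lemma finite_0rank_torsion :
  finite_0rank A ->
  exists s : seq V, forall u, exists2 k, (0 < k)%N & zspan s (u *+ k)%R.
Proof.
move=> [r [X [[XA Xinf iX] maxX Xr]]].
have /finite_seqP[s es] : finite_set X by exists r.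
have [t et] : exists t : seq V, map val t = s.
  by apply: abz_lift_seq => x xs; apply: XA; rewrite es.
exists t => v; have st := zsub_zspan t.
have [vX|vX] := pselect (X (val v)).
  exists 1%N => //; rewrite mulr1n; apply: zspan_mem.
  by move: vX; rewrite es /= -et mem_map //; apply: abz_val_inj.
have [vinf|] := pselect (infinite_order (val v)); last first.
  move=> /contrapT[k [k0 ek _]]; exists k => //.
  rewrite (_ : (v *+ k)%R = 0%R); first by case: st.
  by apply: abz_val_eq1; rewrite abz_valMn.
have ndep : ~ independent (val v |` X).
  move=> iY; apply: vX; rewrite -(maxX (val v |` X)); first by left.
    split=> //; first by move=> x [->|/XA //]; apply: abz_valP.
    by move=> x [->|/Xinf].
  by move=> x; right.
have nY1 : ~ (val v |` X) 1.
  move=> [/esym/abz_val_eq1 e|]; last by case: iX.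
  by have := abz_infinite vinf (ltn0Sn 0); rewrite e mul0rn eqxx.
have [s' [m [us' sY prod1 [x [xs' nx]]]]] : exists (s' : seq G) (m : G -> int),
    [/\ uniq s', forall x, x \in s' -> (val v |` X) x,
        \prod_(x <- s') zexpg x (m x) = 1 &
        exists x, x \in s' /\ zexpg x (m x) <> 1].
  apply: contrapT => no; apply: ndep; split=> // s' m us' sY prod1 x xs'.
  apply: contrapT => nx; apply: no; exists s', m; split=> //.
  by exists x.
have [t' et'] : exists t' : seq V, map val t' = s'.
  apply: abz_lift_seq => y /sY[->|/XA //]; exact: abz_valP.
have ut' : uniq t' by rewrite -(map_inj_uniq (@abz_val_inj _ _ hA cA)) et'.
have sum0 : (\sum_(u <- t') u *~ m (val u) = 0)%R.
  apply: abz_val_eq1; rewrite abz_val_sum -[RHS]prod1 -et' big_map.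
  by apply: eq_bigr => w _; rewrite abz_valMz.
have t'X u : u \in t' -> u != v -> X (val u).
  move=> u't uv; have /sY : val u \in s' by rewrite -et'; apply: map_f.
  by case=> // /abz_val_inj e; rewrite e eqxx in uv.
move: xs'; rewrite -et' => /mapP[w w't ex]; rewrite {}ex in nx.
have nw : (w *~ m (val w) != 0)%R.
  by apply/eqP => e; apply: nx; rewrite -abz_valMz e abz_val0.
pose t2 := rem v t'.
have ft2 : zfree t2.
  apply: independent_zfree iX _ _; first exact: rem_uniq.
  by move=> u; rewrite mem_rem_uniq // inE => /andP[uv u't]; apply: t'X.
have w2 : w != v -> w \in t2 by rewrite mem_rem_uniq // inE w't => ->.
have [v't|v't] := boolP (v \in t'); last first.
  have ew : w != v by apply: contraNneq v't => <-.
  have := ft2.2 (fun u => m (val u)); rewrite /t2 (rem_id v't) => /(_ sum0 w).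
  by move=> /(_ w't) /eqP; rewrite (negPf nw).
move: sum0; rewrite (perm_big _ (perm_to_rem v't)) big_cons /= -/t2 => sum0.
have nv : (v *~ m (val v) != 0)%R.
  apply/negP => /eqP ev; move: sum0; rewrite ev add0r => sum0.
  have ew : w != v by apply: contraNneq nw => ->; rewrite ev.
  by have /eqP := ft2.2 _ sum0 w (w2 ew); rewrite (negPf nw).
have spv : zspan t (v *~ m (val v))%R.
  move/eqP: sum0; rewrite addr_eq0 => /eqP ->; apply: (zsubN st).
  apply: (zsub_sum st) => u; rewrite mem_rem_uniq // inE => /andP[uv u't].
  apply: zsubMz => //; apply: zspan_mem.
  have := t'X _ u't uv.
  by rewrite es /= -et mem_map //; apply: abz_val_inj.
move: spv nv; case: (m (val v)) => [[|k]|k] spv nv.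
- by rewrite mulr0z eqxx in nv.
- by exists k.+1.
- by exists k.+1 => //; rewrite -[(_ *+ _)%R]opprK; apply: (zsubN st).
Qed.

(** Conversely a bound on the size of torsion-free independent lists gives
    finite 0-rank. *)
Lemma bounded_finite_0rank n :
  (forall t : seq V, zfree t -> (forall u, u \in t -> infinite_order (val u)) ->
     (size t <= n)%N) -> finite_0rank A.
Proof.
move=> hn.
pose P t := zfree t /\ forall u, u \in t -> infinite_order (val u).
have [|t [ft it] maxt] := @max_seq V P n _ (fun t Pt => hn t Pt.1 Pt.2).
  by split=> //; split=> // m _ u.
have t0 : 0%R \notin t.
  apply/negP => /it /abz_infinite /(_ 1%N isT).
  by rewrite mul0rn eqxx.
exists (size t), [set` map val t]; split; first split.
- by move=> _ /= /mapP[u _ ->]; apply: abz_valP.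
- by move=> _ /= /mapP[u /it h ->].
- exact: zfree_independent.
- move=> Y [YA Yinf iY] XY; apply/seteqP; split=> // y Yy.
  apply: contrapT => /= ny.
  have [v ev] := abz_surj hA cA (YA _ Yy).
  have vt : v \notin t by apply/negP => vt; apply: ny; rewrite -ev map_f.
  suff /maxt : P (v :: t) by rewrite ltnn.
  have vY u : u \in v :: t -> Y (val u).
    by rewrite inE => /orP[/eqP ->|ut]; [rewrite ev|apply: XY; apply: map_f].
  split; last by move=> u /vY /Yinf.
  by apply: independent_zfree iY _ vY; rewrite /= vt; case: ft.
- rewrite -(size_map val); apply: card_seq.
  by rewrite map_inj_uniq; [case: ft|apply: abz_val_inj].
Qed.

Lemma abz_socle (u : V) : p_socle 2 A (val u) <-> (u *+ 2 = 0)%R.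
Proof.
split=> [[_ e]|e]; first by apply: abz_val_eq1; rewrite abz_valMn.
by split; [exact: abz_valP|rewrite -abz_valMn e abz_val0].
Qed.

(** Elements of the socle are coloured by their coordinates in a basis. *)
Lemma finite_2rank_socle :
  finite_prank 2 A -> exists q, colourable [set u : V | u *+ 2 = 0]%R eq q.
Proof.
move=> [r [X [XA _ spanX] Xr]].
have /finite_seqP[s es] : finite_set X by exists r.
have [t et] : exists t : seq V, map val t = s.
  by apply: abz_lift_seq => x xs; have [] : p_socle 2 A x by apply: XA; rewrite es.
have /choice [d hd] (u : V) : exists d : V -> 'F_2, (u *+ 2 = 0)%R ->
    u = (\sum_(w <- undup t) w *+ (d w : nat))%R.
  have [u2|nu2] := pselect (u *+ 2 = 0)%R; last by exists (fun=> 0%R).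
  have [s' [c [us' sX e]]] := spanX _ ((abz_socle u).2 u2).
  have [t' et'] : exists t' : seq V, map val t' = s'.
    by apply: abz_lift_seq => x /sX /XA [].
  have ut' : uniq t' by rewrite -(map_inj_uniq (@abz_val_inj _ _ hA cA)) et'.
  exists (fun w => if w \in t' then c (val w) else 0%R) => _.
  under eq_bigr => w _ do
    rewrite (fun_if (fun k : 'F_2 => w *+ (k : nat))%R) mulr0n.
  rewrite -(big_seq_extend (fun w => w *+ (c (val w) : nat))%R) ?undup_uniq //.
    apply: abz_val_inj; rewrite abz_val_sum e -et' big_map.
    by apply: eq_bigr => w _; rewrite abz_valMn.
  move=> w wt'; rewrite mem_undup -(mem_map (@abz_val_inj _ _ hA cA)) et.
  have : X (val w) by apply: sX; rewrite -et' map_f.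
  by rewrite es.
exists #|{ffun 'I_(size (undup t)) -> 'F_2}|.
apply: (colourable_fin (c := fun u =>
  [ffun i : 'I_(size (undup t)) => d u (nth 0%R (undup t) i)])).
move=> x y x2 y2 /ffunP e; apply: etrans (hd _ x2) (etrans _ (esym (hd _ y2))).
apply: eq_big_seq => w; rewrite -index_mem => iw.
have := e (Ordinal iw); rewrite !ffunE /= nth_index -?index_mem // => ew.
by congr (_ *+ _)%R; exact: (congr1 (@nat_of_ord _) ew).
Qed.

(** Conversely, a largest list of elements of the socle independent over the
    field with two elements is a basis of the socle. *)
Lemma socle_finite_2rank q :
  colourable [set u : V | u *+ 2 = 0]%R eq q -> finite_prank 2 A.
Proof.
move=> hq.
pose P (t : seq V) := [/\ uniq t, (forall u, u \in t -> u *+ 2 = 0)%R &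
  forall c : V -> 'F_2, (\sum_(u <- t) u *+ (c u : nat) = 0)%R ->
    forall u, u \in t -> c u = 0%R].
have Pq t : P t -> (size t <= q)%N.
  move=> [ut t2 _]; apply: separated_leq hq.
  exists (fun i => nth 0%R t i) => [i|i j /eqP].
    by apply: t2; apply: mem_nth.
  by rewrite nth_uniq // => /eqP/val_inj.
have [//|t [ut t2 ft] maxt] := max_seq _ Pq.
exists (size t), [set` map val t]; last first.
  by rewrite -(size_map val); apply: card_seq; rewrite map_inj_uniq //; apply: abz_val_inj.
split.
- by move=> _ /= /mapP[u /t2 u2 ->]; apply/abz_socle.
- move=> s c us st prod1 x xs.
  have [t' et'] : exists t' : seq V, map val t' = s.
    by apply: abz_lift_seq => y /st /= /mapP[u _ ->]; apply: abz_valP.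
  have ut' : uniq t' by rewrite -(map_inj_uniq (@abz_val_inj _ _ hA cA)) et'.
  have tt' : {subset t' <= t}.
    move=> u u't; have /st /= /mapP[w wt /abz_val_inj ->] // : val u \in s.
    by rewrite -et'; apply: map_f.
  move: xs; rewrite -{1}et' => /mapP[u u't ->].
  have := ft (fun u => if u \in t' then c (val u) else 0%R) _ u (tt' _ u't).
  rewrite u't => -> //.
  under eq_bigr => w _ do
    rewrite (fun_if (fun k : 'F_2 => w *+ (k : nat))%R) mulr0n.
  rewrite -(big_seq_extend (fun w => w *+ (c (val w) : nat))%R) //.
  apply: abz_val_eq1; rewrite abz_val_sum -[RHS]prod1 -et' big_map.
  by apply: eq_bigr => w _; rewrite abz_valMn.
- move=> a a2; have [Aa _] := a2.
  have [v ev] := abz_surj hA cA Aa.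
  have v2 : (v *+ 2 = 0)%R by apply/abz_socle; rewrite ev.
  suff [c hc] : exists c : V -> 'F_2, (v = \sum_(u <- t) u *+ (c u : nat))%R.
    have [c' hc'] := abz_lift_fun (0%R : 'F_2) c.
    exists (map val t), c'; split=> //.
      by rewrite map_inj_uniq //; apply: abz_val_inj.
    rewrite -ev hc abz_val_sum big_map; apply: eq_bigr => w _.
    by rewrite hc' abz_valMn.
  have [vt|vt] := boolP (v \in t).
    exists (fun u => if u == v then 1%R else 0%R).
    rewrite (bigD1_seq v) //= eqxx mulr1n big1 ?addr0 // => u /negPf ->.
    by rewrite mulr0n.
  have nP : ~ P (v :: t) by move=> /maxt; rewrite ltnn.
  have [c [sum0 [u [ut' nu]]]] : exists c : V -> 'F_2,
      (\sum_(u <- v :: t) u *+ (c u : nat) = 0)%R /\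
      exists u, u \in v :: t /\ c u <> 0%R.
    apply: contrapT => no; apply: nP; split=> //=; first by rewrite vt.
      by move=> u; rewrite inE => /orP[/eqP ->|/t2].
    move=> c sum0 u ut'; apply: contrapT => nu; apply: no; exists c.
    by split=> //; exists u.
  exists c; move: sum0; rewrite big_cons.
  have [cv|cv] : c v = 0%R \/ c v = 1%R.
    by case: (c v) => [[|[|//]] i]; [left|right]; apply: val_inj.
    rewrite cv mulr0n add0r => sum0; case: nu; move: ut'; rewrite inE.
    by case/orP => [/eqP ->|] //; apply: ft.
  rewrite cv mulr1n => /eqP; rewrite addr_eq0 => /eqP e.
  have ev2 : v = (- v)%R by apply/eqP; rewrite -addr_eq0 -mulr2n v2.
  by rewrite ev2 {1}e opprK.
Qed.

End Ranks.

(** * Subgroups, conjugation and cosets *)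

Section Groups.
Variable G : groupType.
Implicit Types (x y z g : G) (H K A B : set G).

Lemma subgroup1 H : is_subgroup H -> H 1. Proof. by case. Qed.
Lemma subgroupM H x y : is_subgroup H -> H x -> H y -> H (x * y).
Proof. by case=> _ h _; apply: h. Qed.
Lemma subgroupV H x : is_subgroup H -> H x -> H x^-1.
Proof. by case=> _ _; apply. Qed.
Lemma subgroupX H x n : is_subgroup H -> H x -> H (x ^+ n).
Proof.
move=> sH Hx; elim: n => [|n IH]; first exact: subgroup1.
by rewrite expgS; apply: subgroupM.
Qed.
Lemma subgroup_zexpg H x (m : int) : is_subgroup H -> H x -> H (zexpg x m).
Proof.
move=> sH Hx; case: m => n /=; first exact: subgroupX.
exact: (subgroupV sH (subgroupX n.+1 sH Hx)).
Qed.

Lemma subgroup_gen (X : set G) : is_subgroup (gen X).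
Proof.
split.
- by move=> H [sH _]; apply: subgroup1.
- by move=> x y hx hy H [sH XH]; apply: subgroupM => //; [apply: hx|apply: hy].
- by move=> x hx H [sH XH]; apply: subgroupV => //; apply: hx.
Qed.

Lemma subgroup_cyc x : is_subgroup (cyc x). Proof. exact: subgroup_gen. Qed.

Lemma mem_cyc x : cyc x x. Proof. by move=> H [_]; apply. Qed.

Lemma cyc_sub H x : is_subgroup H -> H x -> cyc x `<=` H.
Proof. by move=> sH Hx; apply: smallest_sub => // _ ->. Qed.

Lemma zexpgN x (m : int) : zexpg x (- m)%R = (zexpg x m)^-1.
Proof. by case: m => [[|n]|n] /=; rewrite ?invg1 ?invgK. Qed.

Lemma zexpg_sub x i j : zexpg x (i%:Z - j%:Z)%R = x ^+ i * x ^- j.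
Proof.
case: (leqP j i) => h; first by rewrite subzn // /= expgnFr.
by rewrite -opprB zexpgN subzn 1?ltnW //= expgnFr 1?ltnW // invgM invgK.
Qed.

Lemma int_split (m : int) : exists i j : nat, m = (i%:Z - j%:Z)%R.
Proof.
by case: m => n; [exists n, 0%N; rewrite subr0|exists 0%N, n.+1; rewrite sub0r NegzE].
Qed.

Lemma zexpgD x (m n : int) : zexpg x (m + n)%R = zexpg x m * zexpg x n.
Proof.
have [i [j ->]] := int_split m; have [k [l ->]] := int_split n.
rewrite addrACA -opprD -!PoszD !zexpg_sub !expgnDr invgM -!mulgA; congr (_ * _).
have c p q : commute (x ^+ p) (x ^- q) by apply/commuteV/commuteX2.
rewrite [RHS]mulgA -(c k j) -mulgA; congr (_ * _).
by rewrite -!expVgn -!expgnDr addnC.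
Qed.

Lemma zexpgM x (m n : int) : zexpg x (m * n)%R = zexpg (zexpg x m) n.
Proof.
have hn k : zexpg x (m * k%:Z)%R = zexpg x m ^+ k.
  elim: k => [|k IH]; first by rewrite mulr0.
  by rewrite -add1n PoszD mulrDr mulr1 zexpgD IH expgS.
case: n => n; first exact: hn.
by rewrite NegzE mulrN [LHS]zexpgN [RHS]zexpgN; congr (_^-1); exact: hn.
Qed.

Lemma conj_zexpg x (m : int) g : zexpg x m ^ g = zexpg (x ^ g) m.
Proof. by case: m => n; rewrite /= ?conjVg conjXg. Qed.

Lemma zexpg1 x : zexpg x 1%R = x. Proof. by []. Qed.

Lemma cycP x y : cyc x y <-> exists m : int, y = zexpg x m.
Proof.
split=> [|[m ->]]; last by exact: (subgroup_zexpg m (subgroup_cyc x) (mem_cyc (x := x))).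
apply: (@cyc_sub [set y | exists m : int, y = zexpg x m]); last by exists 1%R.
split; first by exists 0%R.
- by move=> _ _ [m ->] [n ->]; exists (m + n)%R; rewrite zexpgD.
- by move=> _ [m ->]; exists (- m)%R; rewrite zexpgN.
Qed.

Lemma infinite_zexpg x (m : int) : infinite_order x -> zexpg x m = 1 -> m = 0%R.
Proof.
move=> /infinite_orderP h; case: m => [[|n]|n] //= e.
  by case: (h n.+1).
by case: (h n.+1) => //; rewrite -[LHS]invgK e invg1.
Qed.

Lemma infinite_zexpg_inj x (m n : int) :
  infinite_order x -> zexpg x m = zexpg x n -> m = n.
Proof.
move=> h e; apply/eqP; rewrite -subr_eq0; apply/eqP; apply: infinite_zexpg h _.
by rewrite zexpgD zexpgN e mulgV.
Qed.

Lemma conj_set_id H g :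
  (forall h, H h -> H (h ^ g)) -> (forall h, H h -> H (h ^ g^-1)) ->
  conj_set H g = H.
Proof.
move=> h1 h2; apply/seteqP; split=> [_ [h /h1 Hh <-] //|h /h2 Hh].
by exists (h ^ g^-1) => //; rewrite conjgKV.
Qed.

Lemma commute_conj x y : commute x y -> x ^ y = x.
Proof. by move=> e; rewrite conjgE e mulKg. Qed.

Lemma conj_commute x y : x ^ y = x -> commute x y.
Proof. by move=> e; rewrite /commute conjgC e. Qed.

(** The relation of lying in the same right coset of [H]. *)
Definition eqcoset H x y := H (x * y^-1).

Lemma index_leP K H n :
  is_subgroup H -> (0 < n)%N -> index_le K H n <-> colourable K (eqcoset H) n.
Proof.
move=> sH n0; split.
  move=> /pcard_leP /unsquash f; case: n n0 f => // n _ f.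
  exists (fun x => inord (f [set h * x | h in H])) => x y Kx Ky e.
  have hf w : K w -> right_cosets K H [set h * w | h in H] by exists w.
  have fl w : K w -> (f [set (h * w)%g | h in H] < n.+1)%N.
    by move=> /hf /(@funS _ _ _ _ f).
  have /(congr1 (@nat_of_ord _)) := e; rewrite !inordK ?fl // => {}e.
  have ex : [set (h * x)%g | h in H] = [set h * y | h in H].
    by apply: (@inj _ _ _ f) e; apply/mem_set; apply: hf.
  have : [set (h * x)%g | h in H] x by exists 1; rewrite ?mul1g //; apply: subgroup1.
  by rewrite ex => -[h Hh <-]; rewrite /eqcoset mulgK.
move=> [c hc].
have /choice [rep hrep] (S : set G) : exists x, right_cosets K H S ->
    K x /\ S = [set h * x | h in H].
  have [[x Kx <-]|no] := pselect (right_cosets K H S); last by exists 1.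
  by exists x.
have [f] : $|{injfun right_cosets K H >-> `I_n}|.
  apply/injfunPex; exists (fun S => nat_of_ord (c (rep S))).
    by move=> S _ /=.
  move=> S T /set_mem hS /set_mem hT /val_inj e.
  have [KS eS] := hrep _ hS; have [KT eT] := hrep _ hT.
  have Hst := hc _ _ KS KT e; rewrite /eqcoset in Hst.
  rewrite eS eT; apply/seteqP; split=> _ [h Hh <-].
    exists (h * (rep S * (rep T)^-1)); first exact: subgroupM.
    by rewrite !mulgA mulgVK.
  exists (h * (rep S * (rep T)^-1)^-1).
    by apply: subgroupM => //; apply: subgroupV.
  by rewrite invgM invgK !mulgA mulgVK.
exact: inj_card_le f.
Qed.

Lemma index_le_sub K K' H n : K `<=` K' -> index_le K' H n -> index_le K H n.
Proof.
move=> sK; apply: card_le_trans; apply: subset_card_le => _ [x /sK Kx <-].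
by exists x.
Qed.

Lemma centraliser_normaliser x : centraliser x `<=` normaliser (cyc x).
Proof.
move=> y /commute_conj e; apply: conj_set_id => _ /cycP[m ->]; apply/cycP;
  exists m; rewrite conj_zexpg ?e //.
by rewrite -{1}e conjgK.
Qed.

End Groups.

(** * Non-periodic BCI-groups *)

Section Structure.
Variable G : groupType.
Implicit Types (x y z w g : G) (H K A B : set G).

Lemma infinite_orderX x k : (0 < k)%N -> infinite_order x -> infinite_order (x ^+ k).
Proof.
move=> k0 /infinite_orderP h; apply/infinite_orderP => l l0.
by rewrite -expgnA; apply: h; rewrite muln_gt0 k0.
Qed.

(** All large powers of an element of infinite order generate normal
    subgroups: the powers [1, z, ..., z ^+ n] lie in the centraliser of
    [z ^+ k] and in distinct cosets of its powers when [n < k]. *)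
Lemma BCI_normal_powers z :
  BCI G -> infinite_order z ->
  exists n, forall k, (n < k)%N -> is_normal (cyc (z ^+ k)).
Proof.
move=> [n n0 hn] zinf; exists n => k nk; apply: contrapT => /hn.
move=> /(index_leP _ (subgroup_cyc _) n0) col.
suff : (n.+1 <= n)%N by rewrite ltnn.
apply: separated_leq col; exists (fun i : 'I_n.+1 => z ^+ i) => [i|i j].
  exact: commuteX2.
move=> /cycP[m]; rewrite -zexpg_sub -[z ^+ k]/(zexpg z k) -zexpgM.
move=> /(infinite_zexpg_inj zinf) e; apply: val_inj => /=.
have hi := ltn_ord i; have hj := ltn_ord j.
have m0 : m = 0%R by nia.
by move: e; rewrite m0; lia.
Qed.

(** The subgroup generated by [z] is itself normal, because [z] is the quotient
    of [z ^+ n.+2] by [z ^+ n.+1]. *)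
Lemma BCI_conj_infinite z g :
  BCI G -> infinite_order z -> z ^ g = z \/ z ^ g = z^-1.
Proof.
move=> hB zinf; have [n hn] := BCI_normal_powers hB zinf.
have hpow h : exists a : int, z ^ h = zexpg z a.
  have hk k : (n < k)%N -> exists a : int, (z ^+ k) ^ h = zexpg (z ^+ k) a.
    move=> /hn /(_ h) e; apply/cycP; rewrite -e.
    by exists (z ^+ k) => //; apply: mem_cyc.
  have [a ea] := hk n.+1 (ltnSn _); have [b eb] := hk n.+2 (leqnSn _).
  exists (n.+2%:Z * b - n.+1%:Z * a)%R.
  rewrite zexpgD zexpgN !zexpgM -eb -ea -conjVg -conjMg; congr (_ ^ h).
  by rewrite expgS mulgK.
have [a ea] := hpow g; have [b eb] := hpow g^-1.
have e1 : (a * b = 1)%R.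
  apply: (infinite_zexpg_inj zinf).
  by rewrite zexpgM -ea -conj_zexpg -eb conjgKV zexpg1.
have {e1} : (`|a| * `|b| = 1)%N by rewrite -abszM e1.
move/eqP; rewrite muln_eq1 => /andP[/eqP a1 _].
have [ea1|ea1] : a = 1%R \/ a = (-1)%R by lia.
  by left; rewrite ea ea1.
by right; rewrite ea ea1.
Qed.

Lemma invg_infinite z : infinite_order z -> z^-1 <> z.
Proof.
move=> /infinite_orderP h e; apply: (h 2) => //.
by rewrite expg2 -{2}e mulgV.
Qed.

(** No [g] centralises one element of infinite order and inverts another: if
    [z ^ g = z] and [w ^ g = w^-1], then [z] commutes with [w ^+ 2], and neither
    the case where [z * w ^+ 2] has finite order nor the other one is
    possible. *)
Lemma BCI_dichotomy g :
  BCI G -> (forall z, infinite_order z -> z ^ g = z) \/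
           (forall z, infinite_order z -> z ^ g = z^-1).
Proof.
move=> hB; apply: contrapT => /not_orP[/existsNP[w nw] /existsNP[z nz]].
have [winf {}nw] : infinite_order w /\ w ^ g = w^-1.
  split; first by apply: contrapT => h; apply: nw.
  have winf : infinite_order w by apply: contrapT => h; apply: nw.
  by have [e|//] := BCI_conj_infinite g hB winf; case: nw.
have [zinf {}nz] : infinite_order z /\ z ^ g = z.
  split; first by apply: contrapT => h; apply: nz.
  have zinf : infinite_order z by apply: contrapT => h; apply: nz.
  by have [//|e] := BCI_conj_infinite g hB zinf; case: nz.
pose v := w ^+ 2.
have vinf : infinite_order v by apply: infinite_orderX.
have vg : v ^ g = v^-1 by rewrite conjXg nw expVgn.
have zv : commute z v.
  apply: conj_commute; rewrite /v expg2 conjgM.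
  have [e|e] := BCI_conj_infinite w hB zinf; first by rewrite !e.
  by rewrite e conjVg e invgK.
clearbody v; have [zvinf|] := pselect (infinite_order (z * v)).
  have := BCI_conj_infinite g hB zvinf; rewrite conjMg nz vg => -[/mulgI|].
    exact: invg_infinite.
  by rewrite zv invgM => /mulIg /esym; apply: invg_infinite.
move=> /contrapT[k [k0 ek _]].
have ezv : z ^+ k = v ^- k.
  by rewrite -[LHS](mulgK (v ^+ k)) -(expgMn _ zv) ek mul1g.
have := congr1 (fun x => x ^ g) ezv; rewrite -expVgn !conjXg nz conjVg vg invgK.
rewrite ezv; apply: invg_infinite; exact: infinite_orderX.
Qed.

(** The centraliser of all elements of infinite order. *)
Definition inf_centraliser : set G :=
  [set a | forall z, infinite_order z -> z ^ a = z].

Lemma inf_centraliser_subgroup : is_subgroup inf_centraliser.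
Proof.
split; first by move=> z _; rewrite conjg1.
- by move=> a b ha hb z zinf; rewrite conjgM ha ?hb.
- by move=> a ha z zinf; rewrite -{1}(ha z zinf) conjgK.
Qed.

Lemma BCI_infinite_mem z : BCI G -> infinite_order z -> inf_centraliser z.
Proof.
move=> hB zinf; have [//|h] := BCI_dichotomy z hB.
by have := h _ zinf; rewrite commute_conj // => /esym /invg_infinite.
Qed.

Lemma infinite_mul_finite x z :
  commute x z -> infinite_order z -> ~ infinite_order x -> infinite_order (x * z).
Proof.
move=> xz /infinite_orderP zinf /contrapT[k [k0 ek _]].
apply/infinite_orderP => l l0 e; apply: (zinf (k * l)%N).
  by rewrite muln_gt0 k0.
have xkl : x ^+ (k * l) = 1 by rewrite expgnA ek expg1n.
by rewrite -[LHS]mul1g -{1}xkl -(expgMn _ xz) mulnC expgnA e expg1n.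
Qed.

(** Every element of [inf_centraliser] is a product of elements of infinite
    order, so whatever holds for these extends to it. *)
Lemma inf_centraliser_abelian :
  BCI G -> non_periodic [set: G] -> abelian_set inf_centraliser.
Proof.
move=> hB [z _ zinf] a b ha hb.
have Az := BCI_infinite_mem hB zinf.
have [binf|bfin] := pselect (infinite_order b).
  by apply/commute_sym/conj_commute/ha.
have bz : commute b z by apply/commute_sym/conj_commute/hb.
have bzinf := infinite_mul_finite bz zinf bfin.
apply: commute_sym; apply: conj_commute.
by have := ha _ bzinf; rewrite conjMg (ha _ zinf) => /mulIg.
Qed.

Lemma BCI_invert g a :
  BCI G -> non_periodic [set: G] -> ~ inf_centraliser g ->
  inf_centraliser a -> a ^ g = a^-1.
Proof.
move=> hB [z _ zinf] ng ha.
have inv w : infinite_order w -> w ^ g = w^-1.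
  by have [//|] := BCI_dichotomy g hB; apply.
have [ainf|afin] := pselect (infinite_order a); first exact: inv.
have az : commute a z by apply/commute_sym/conj_commute/ha.
have := inv _ (infinite_mul_finite az zinf afin).
by rewrite conjMg (inv _ zinf) az invgM => /mulIg.
Qed.

(** [inverting A]: [A] is an abelian subgroup of [G], of index at most 2 and
    inverted by every element outside it. *)
Definition inverting A :=
  [/\ is_subgroup A, abelian_set A,
      (forall x y, ~ A x -> A y \/ A (x^-1 * y)) &
      (forall x a, ~ A x -> A a -> a ^ x = a^-1)].

Lemma inverting_sqr A x : inverting A -> ~ A x -> A (x ^+ 2).
Proof.
move=> [sA _ cov _] nx; have [//|] := cov x (x ^+ 2) nx.
by rewrite expg2 mulKg.
Qed.

Lemma inverting_exp4 A x : inverting A -> ~ A x -> x ^+ 4 = 1.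
Proof.
move=> hA nx; have A2 := inverting_sqr hA nx; have [_ _ _ inv] := hA.
have := inv _ _ nx A2; rewrite commute_conj; last exact/commute_sym/commuteX.
by move=> e; rewrite (expgnDr x 2 2) {2}e mulgV.
Qed.

Lemma BCI_inverting :
  BCI G -> non_periodic [set: G] ->
  exists A, inverting A /\ non_periodic A.
Proof.
move=> hB hG; exists inf_centraliser; split; last first.
  by have [z _ zinf] := hG; exists z => //; apply: BCI_infinite_mem.
split; [exact: inf_centraliser_subgroup|exact: inf_centraliser_abelian| |].
- move=> x y nx; have [hy|hy] := BCI_dichotomy y hB; first by left.
  have [//|hx] := BCI_dichotomy x hB.
  right=> z zinf; rewrite conjgM.
  have -> : z ^ x^-1 = z^-1 by rewrite -[LHS]invgK -conjVg -(hx z zinf) conjgK hx.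
  by rewrite conjVg hy // invgK.
- by move=> x a nx Aa; apply: BCI_invert.
Qed.

End Structure.

(** * Normalisers in groups with an inverted abelian subgroup *)

(** The subgroup generated by [B] and [g], for a subgroup [B] that contains
    [g ^+ 2] and is inverted by [g]. *)
Definition dih (G : groupType) (g : G) (B : set G) : set G := [set x | B x \/ B (g^-1 * x)].

Lemma dih_subgroup (G : groupType) (g : G) (B : set G) :
  is_subgroup B -> (forall b, B b -> b ^ g = b^-1) -> B (g ^+ 2) ->
  is_subgroup (dih g B).
Proof.
move=> sB invB B2.
have Bg b : B b -> dih g B (g * b) by right; rewrite mulKg.
have dihP x : dih g B x -> B x \/ exists2 b, B b & x = g * b.
  by case=> [|Bx]; [left|right; exists (g^-1 * x); rewrite ?mulVKg].
split; first by left; apply: subgroup1.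
- move=> x y /dihP[Bx|[b Bb ->]] /dihP[By|[c Bc ->]].
  + by left; apply: subgroupM.
  + rewrite mulgA [x * g]conjgC invB // -mulgA; apply: Bg.
    by apply: subgroupM => //; apply: subgroupV.
  + by rewrite -mulgA; apply: Bg; apply: subgroupM.
  + left; rewrite -mulgA [b * (g * c)]mulgA [b * g]conjgC invB // -mulgA mulgA -expg2.
    by apply: subgroupM => //; apply: subgroupM => //; apply: subgroupV.
- move=> x /dihP[Bx|[b Bb ->]]; first by left; apply: subgroupV.
  have -> : (g * b)^-1 = g * (b * (g ^+ 2)^-1).
    have eb : b = b^-1 ^ g by rewrite conjVg invB // invgK.
    apply: (canRL (mulVKg g)).
    by rewrite [b in RHS]eb conjgE expg2 !invgM !mulgA mulgK.
  by apply: Bg; apply: subgroupM => //; apply: subgroupV.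
Qed.

Section Inverting.
Variables (G : groupType) (A : set G).
Hypothesis hinv : inverting A.
Implicit Types (x y g : G) (H B : set G).

Lemma inverting_normal H : is_subgroup H -> H `<=` A -> is_normal H.
Proof.
have [sA cA _ inv] := hinv; move=> sH HA.
have hc x h : H h -> H (h ^ x).
  move=> Hh; have [Ax|nx] := pselect (A x); last first.
    by rewrite (inv _ _ nx (HA _ Hh)); apply: subgroupV.
  by rewrite commute_conj //; apply: cA => //; apply: HA.
by move=> g; apply: conj_set_id => h; apply: hc.
Qed.

Lemma inverting_conj g a : ~ A g -> A a -> g ^ a = g * a ^+ 2.
Proof.
have [sA _ _ inv] := hinv; move=> ng Aa.
rewrite conjgE mulgA [a^-1 * g]conjgC (inv _ _ ng (subgroupV sA Aa)).
by rewrite invgK expg2 mulgA.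
Qed.

Lemma dih_meet g B x : is_subgroup B -> B `<=` A -> ~ A g -> A x -> dih g B x -> B x.
Proof.
have [sA _ _ _] := hinv; move=> sB BA ng Ax [//|/BA Agx]; case: ng.
have -> : g = x * (g^-1 * x)^-1 by rewrite invgM invgK mulVKg.
by apply: subgroupM => //; apply: subgroupV.
Qed.

Lemma dih_normaliser g B a :
  is_subgroup B -> B `<=` A -> ~ A g -> A a -> B (a ^+ 2) ->
  normaliser (dih g B) a.
Proof.
have [sA cA _ _] := hinv; move=> sB BA ng Aa B2.
have step c h : A c -> B (c ^+ 2) -> dih g B h -> dih g B (h ^ c).
  move=> Ac Bc [Bh|Bh].
    by left; rewrite commute_conj //; apply: cA => //; apply: BA.
  right; rewrite -[h in h ^ c](mulVKg g) conjMg inverting_conj // -mulgA mulKg.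
  apply: subgroupM => //.
  by rewrite commute_conj //; apply: cA => //; apply: BA.
apply: conj_set_id => h; apply: step => //; first exact: subgroupV.
by rewrite expVgn; apply: subgroupV.
Qed.

Local Notation V hA cA := (abz (A := A) hA cA).

(** In a BNI-group the sections [{u | 2u in B} / B] are bounded, uniformly in
    the subgroups [B] of [A] containing [g ^+ 2] for which [dih g B] is not
    normal. *)
Lemma BNI_halving (hA : is_subgroup A) (cA : abelian_set A) g n
    (B : set (V hA cA)) (w z : V hA cA) :
  (0 < n)%N ->
  (forall H, is_subgroup H -> ~ is_normal H -> index_le (normaliser H) H n) ->
  ~ A g -> abz_val w = g ^+ 2 -> zsub B -> B w -> ~ B (z *+ 2)%R ->
  colourable [set u : V hA cA | B (u *+ 2)%R] (eqmod B) n.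
Proof.
move=> n0 hn ng ew sB Bw nz.
pose B' : set G := (@abz_val G A hA cA) @` B.
have B'B u : B' (abz_val u) -> B u by move=> [v Bv /abz_val_inj <-].
have BB' u : B u -> B' (abz_val u) by exists u.
have B'A : B' `<=` A by move=> _ [u _ <-]; apply: abz_valP.
have sB' : is_subgroup B'.
  split; first by rewrite -(abz_val0 hA cA); apply: BB'; case: sB.
  - by move=> _ _ [u Bu <-] [v Bv <-]; rewrite -abz_valD; apply: BB'; apply: zsubD.
  - by move=> _ [u Bu <-]; rewrite -abz_valN; apply: BB'; apply: zsubN.
have B'2 : B' (g ^+ 2) by rewrite -ew; apply: BB'.
have [_ _ _ inv] := hinv.
have sH := dih_subgroup sB' (fun b Bb => inv _ _ ng (B'A _ Bb)) B'2.
have nH : ~ is_normal (dih g B').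
  move=> /(_ (abz_val z)) e; apply: nz; apply: B'B; rewrite abz_valMn.
  have Az := abz_valP z.
  apply: (dih_meet sB' B'A ng); first exact: subgroupX.
  have Hg : dih g B' g by right; rewrite mulVg; apply: subgroup1.
  have : dih g B' (g ^ abz_val z) by rewrite -{1}e; exists g.
  rewrite inverting_conj // => Hgz.
  rewrite -[X in dih _ _ X](mulKg g).
  by apply: subgroupM => //; apply: subgroupV.
have [c hc] := (index_leP _ sH n0).1 (hn _ sH nH).
exists (fun u => c (abz_val u)) => u v Bu Bv e; apply: B'B.
rewrite abz_valD abz_valN.
apply: (dih_meet sB' B'A ng).
  by rewrite -abz_valN -abz_valD; apply: abz_valP.
by apply: hc => //; apply: dih_normaliser => //; try exact: abz_valP;
  rewrite -abz_valMn; apply: BB'.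
Qed.

(** Taking [B] of order at most 2 bounds the 2-torsion of [A].  Taking for [B]
    the subgroup generated by [g ^+ 2] and the [4u], with [u] in a torsion-free
    independent list, bounds the length of that list, because the [2u] are
    distinct modulo [B]. *)
Lemma BNI_finite_ranks :
  BNI G -> non_periodic A -> (exists g, ~ A g) ->
  finite_0rank A /\ finite_prank 2 A.
Proof.
move=> [n n0 hn] [z0 Az0 zinf] [g ng].
have [hA cA _ _] := hinv.
have [w ew] := abz_surj hA cA (inverting_sqr hinv ng).
have [z ez] := abz_surj hA cA Az0; rewrite -{}ez in zinf.
have w2 : (w *+ 2 = 0)%R.
  by apply: abz_val_eq1; rewrite abz_valMn ew -expgnA (inverting_exp4 hinv).
have wN : (- w = w)%R by apply/eqP; rewrite eq_sym -addr_eq0 -mulr2n w2.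
split.
- apply: (bounded_finite_0rank (hA := hA) (cA := cA) (n := n)) => t [ut ft] tinf.
  pose S (k : abz hA cA -> int) := (\sum_(u <- t) u *~ k u)%R.
  pose B : set (abz hA cA) := [set b | exists k (i : int),
    b = S (fun u => 4%:Z * k u)%R + w *~ i]%R.
  have SB k k' : (S k - S k' = S (fun u => k u - k' u))%R.
    by rewrite /S -sumrB; apply: eq_bigr => u _; rewrite mulrzBr.
  have sB : zsub B.
    split.
      by exists (fun=> 0%R), 0%R; rewrite mulr0z addr0 /S big1.
    move=> _ _ [k [i ->]] [k' [j ->]]; exists (fun u => k u - k' u)%R, (i - j)%R.
    rewrite opprD addrACA SB mulrzBr; congr (_ + _)%R.
    by apply: eq_bigr => u _; rewrite mulrBr.
  have Bw : B w.
    by exists (fun=> 0%R), 1%R; rewrite mulr1z /S big1 ?add0r.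
  have B4 k u : B (S k) -> u \in t -> exists l : int, k u = (4%:Z * l)%R.
    move=> [l [i e]] ut'; exists (l u).
    (* Doubling kills the contribution of [w], which is 2-torsion. *)
    have e2 : (S (fun u => k u * 2 - 4%:Z * l u * 2) = 0)%R.
      rewrite -SB; apply/eqP; rewrite subr_eq0; apply/eqP.
      have S2 h : (S (fun u => h u * 2%:Z) = S h *+ 2)%R.
        by rewrite /S -sumrMnl; apply: eq_bigr => v _; rewrite mulrzA.
      by rewrite !S2 e mulrnDl [(w *~ i *+ 2)%R]pmulrn mulrzAC -pmulrn w2 mul0rz addr0.
    have := abz_infinite_mulrz (tinf _ ut') (ft _ e2 _ ut').
    lia.
  have Sd u : u \in t -> (u *+ 2 = S (fun v => if v == u then 2%:Z else 0))%R.
    move=> ut'; rewrite /S (bigD1_seq u) //= eqxx big1 ?addr0 // => v /negPf ->.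
    by rewrite mulr0z.
  case et : t => [//|u0 t'].
  have u0t : u0 \in t by rewrite et mem_head.
  have nu0 : ~ B (u0 *+ 2)%R.
    by rewrite Sd // => /B4 /(_ u0t)[l]; rewrite eqxx; lia.
  have col := BNI_halving n0 hn ng ew sB Bw nu0.
  rewrite -et; apply: separated_leq col; exists (fun i => nth 0%R t i *+ 2)%R => [i|i j].
    have it := mem_nth 0%R (ltn_ord i).
    exists (fun v => if v == nth 0%R t i then 1%R else 0%R), 0%R.
    rewrite mulr0z addr0 (Sd _ it) /S -sumrMnl; apply: eq_bigr => v _.
    by case: ifP => _; rewrite ?mulr0 ?mulr0z ?mul0rn // [LHS]pmulrn -mulrzA.
  have it := mem_nth 0%R (ltn_ord i); have jt := mem_nth 0%R (ltn_ord j).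
  rewrite /eqmod !Sd // SB => /B4 /(_ it)[l]; rewrite eqxx.
  case: eqP => [e _|_]; last by lia.
  apply/val_inj/eqP.
  by rewrite -(nth_uniq 0%R (ltn_ord i) (ltn_ord j) ut) e.
- pose B : set (abz hA cA) := [set u | u = 0 \/ u = w]%R.
  have sB : zsub B.
    split; first by left.
    move=> x y [->|->] [->|->]; rewrite ?subr0 ?subrr; [left|right|right|left] => //.
    by rewrite sub0r.
  have nz : ~ B (z *+ 2)%R.
    move=> [e|e]; first by have := abz_infinite zinf (ltn0Sn 1); rewrite e eqxx.
    by have := abz_infinite zinf (ltn0Sn 3); rewrite (mulrnA z 2 2) e w2 eqxx.
  have col := BNI_halving n0 hn ng ew sB (or_intror erefl) nz.
  apply: (@socle_finite_2rank _ _ hA cA (n * 2)).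
  apply: (@colourable_trans _ _ (eqmod B)); first by exists 0%R; rewrite /= mul0rn.
    by apply: colourable_sub col => u /= ->; left.
  move=> r r2; have <- : #|{: bool}| = 2%N by rewrite card_bool.
  apply: (colourable_fin (c := fun u => u == r)) => x y [x2 hx] [y2 hy].
  case: eqP => [->|nx] /esym; first by move/eqP.
  move/eqP => ny; case: hx => [/eqP|]; first by rewrite subr_eq0 => /eqP.
  move=> ex; case: hy => [/eqP|ey]; first by rewrite subr_eq0 => /eqP.
  by apply: (addIr (- r)%R); rewrite ex ey.
Qed.

(** A non-normal subgroup [H] contains some [h] outside [A].  Modulo [H], every
    element of the normaliser of [H] has a representative in [A], and [a] in [A]
    normalises [H] only if [a ^+ 2] lies in [H]. *)
Lemma finite_ranks_BNI :
  finite_0rank A -> finite_prank 2 A -> BNI G.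
Proof.
have [hA cA cov inv] := hinv; move=> h0 h2.
have [s tors] := finite_0rank_torsion hA cA h0.
have [q soc] := finite_2rank_socle hA cA h2.
have [n hn] := colourable_halving tors soc.
have n0 : (0 < n)%N.
  have [c _] : colourable [set u : abz hA cA | True] (eqmod [set: abz hA cA]) n by apply: hn.
  by apply: leq_ltn_trans (ltn_ord (c 0%R)).
exists n => // H sH nH; apply/index_leP => //.
have [h [Hh nh]] : exists h, H h /\ ~ A h.
  apply: contrapT => no; apply: nH; apply: inverting_normal => // x Hx.
  by apply: contrapT => nx; apply: no; exists x.
pose B : set (abz hA cA) := [set u | H (abz_val u)].
have sB : zsub B.
  split; first by rewrite /B /= abz_val0; apply: subgroup1.
  move=> u v Bu Bv; rewrite /B /= abz_valD abz_valN.
  by apply: subgroupM => //; apply: subgroupV.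
have [c hc] := hn B sB.
have /choice [f hf] x : exists u : abz hA cA,
    exists k, [/\ H k, x = k * abz_val u & h ^ k = h].
  have [Ax|nx] := pselect (A x).
    have [u eu] := abz_surj hA cA Ax.
    by exists u, 1; rewrite mul1g conjg1; split=> //; apply: subgroup1.
  have [//|Ahx] := cov h x nh.
  have [u eu] := abz_surj hA cA Ahx.
  by exists u, h; rewrite eu mulVKg commute_conj.
exists (fun x => c (f x)) => x y Nx Ny e.
have B2 t : normaliser H t -> B (f t *+ 2)%R.
  move=> Nt; have [k [Hk et hk]] := hf t.
  have : H (h ^ (k * abz_val (f t))) by rewrite -et -Nt; exists h.
  rewrite conjgM hk inverting_conj //; last exact: abz_valP.
  rewrite -abz_valMn => Hf.
  by have := subgroupM sH (subgroupV sH Hh) Hf; rewrite mulKg.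
have := hc _ _ (B2 _ Nx) (B2 _ Ny) e; rewrite /eqmod /B /= abz_valD abz_valN => Hxy.
have [k [Hk ex _]] := hf x; have [l [Hl ey _]] := hf y.
rewrite /eqcoset {1}ex {1}ey invgM.
rewrite -mulgA [abz_val (f x) * _]mulgA.
by apply: subgroupM => //; apply: subgroupM => //; apply: subgroupV.
Qed.

End Inverting.

(** * The theorem *)

(** If the subgroup generated by [x] is not normal, then [x] is outside [A] and
    [x ^+ 4 = 1], so conjugation by the normaliser gives at most four values
    [x ^ t]; those [t] with the same value form a coset of the centraliser. *)
Lemma BCI_cyc_normaliser (G : groupType) :
  non_periodic [set: G] -> BCI G ->
  exists2 n, (0 < n)%N & forall x : G, ~ is_normal (cyc x) ->
    index_le (normaliser (cyc x)) (cyc x) n.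
Proof.
move=> hG hB; have [A [hinv _]] := BCI_inverting hB hG.
have [sA _ _ _] := hinv.
have [n n0 hn] := hB; exists (4 * n)%N => [|x nx]; first by rewrite muln_gt0.
have sx := subgroup_cyc x.
apply/index_leP => //; first by rewrite muln_gt0.
have [Ax|nAx] := pselect (A x).
  by case: nx; apply: (inverting_normal hinv) => //; apply: cyc_sub.
have x4 := inverting_exp4 hinv nAx.
have [c hc] := (index_leP _ sx n0).1 (hn _ nx).
have /choice [d hd] t : exists i : 'I_4, normaliser (cyc x) t -> x ^ t = x ^+ i.
  have [Nt|] := pselect (normaliser (cyc x) t); last by exists ord0.
  have : cyc x (x ^ t) by rewrite -Nt; exists x => //; apply: mem_cyc.
  move=> /cycP[m em].
  have m4 : (`|(m %% 4)%Z| < 4)%N by lia.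
  exists (Ordinal m4) => _; rewrite em /= (divz_eq m 4) mulrC zexpgD zexpgM.
  have -> : zexpg x 4 = 1 by exact: x4.
  have -> : zexpg (1 : G) (m %/ 4)%Z = 1.
    by case: (m %/ 4)%Z => k /=; rewrite expg1n ?invg1.
  rewrite mul1g -[x ^+ _]/(zexpg x (Posz _)); congr (zexpg x _).
  lia.
apply: (@colourable_trans _ _ (fun s t => x ^ s = x ^ t)).
- by exists 1; apply: conj_set_id => h; rewrite ?invg1 conjg1.
- by exists d => s t Ns Nt e; rewrite (hd s Ns) (hd t Nt) e.
move=> r Nr; exists (fun t => c (t * r^-1)) => s t [Ns es] [Nt et] e.
rewrite /eqcoset -(mulgKA r^-1).
by apply: hc => //; apply: conj_commute; rewrite conjgM ?es ?et conjgK.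
Qed.

Lemma inverting_gen (G : groupType) (g : G) (A : set G) :
  is_subgroup A -> abelian_set A -> gen ([set g] `|` A) = [set: G] ->
  A (g ^+ 2) -> (forall a, A a -> a ^ g = a^-1) -> inverting A.
Proof.
move=> sA cA genA A2 inv.
have cover x : dih g A x.
  have : gen ([set g] `|` A) x by rewrite genA.
  apply; split=> [|y [->|Ay]]; [exact: dih_subgroup| |by left].
  by right; rewrite mulVg; apply: subgroup1.
split=> // [x y|x a] nx.
  have [//|Ax] := cover x; have [Ay|Ay] := cover y; [by left|right].
  rewrite (_ : x^-1 * y = (g^-1 * x)^-1 * (g^-1 * y)).
    by apply: subgroupM => //; apply: subgroupV.
  by rewrite invgM invgK -mulgA mulVKg.
have [//|Ax] := cover x; move=> Aa; rewrite -[x](mulVKg g) conjgM inv //.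
by rewrite commute_conj //; apply: cA => //; apply: subgroupV.
Qed.

Lemma abelian_normal (G : groupType) (H : set G) :
  abelian_set [set: G] -> is_normal H.
Proof.
by move=> cG g; apply: conj_set_id => h Hh; rewrite commute_conj //; apply: cG.
Qed.

Lemma BNI_BCI (G : groupType) : BNI G -> BCI G.
Proof.
move=> [n n0 hn]; exists n => // x nx.
apply: index_le_sub (@centraliser_normaliser _ x) (hn _ _ nx).
exact: subgroup_cyc.
Qed.

Theorem theorem3p5 (G : groupType) (hG : non_periodic [set: G]) :
  (BNI G <->
     abelian_set [set: G] \/
     exists (g : G) (A : set G),
       [/\ is_subgroup A, abelian_set A, non_periodic A, finite_0rank A &
           finite_prank 2 A] /\
       [/\ gen ([set g] `|` A) = [set: G],
           (exists2 k, is_order g k & (k <= 4)%N),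
           A (g ^+ 2) &
           forall a, A a -> a ^ g = a^-1])
  /\
  ((exists2 n, (0 < n)%N &
      forall x : G, ~ is_normal (cyc x) ->
        index_le (normaliser (cyc x)) (cyc x) n)
   <-> BCI G).
Proof.
split; last first.
  split=> [[n n0 hn]|]; last exact: BCI_cyc_normaliser.
  exists n => // x nx.
  exact: index_le_sub (@centraliser_normaliser _ x) (hn _ nx).
split=> [hB|[cG|[g [A [[sA cA _ r0 r2] [genA _ A2 inv]]]]]].
- have [A [hinv npA]] := BCI_inverting (BNI_BCI hB) hG.
  have [sA cA cov inv] := hinv.
  have [[g ng]|noA] := pselect (exists g, ~ A g); last first.
    by left=> x y _ _; apply: cA; apply: contrapT => h; apply: noA; [exists x|exists y].
  have [r0 r2] := BNI_finite_ranks hinv hB npA (ex_intro _ g ng).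
  right; exists g, A; split; first by split.
  split; last 1 first.
  - by move=> a; apply: inv.
  - apply/seteqP; split=> // x _.
    have sX := subgroup_gen ([set g] `|` A).
    have Xg : gen ([set g] `|` A) g by apply: sub_gen_smallest; left.
    have XA a : A a -> gen ([set g] `|` A) a.
      by move=> Aa; apply: sub_gen_smallest; right.
    have [/XA //|/XA Xgx] := cov g x ng.
    by have := subgroupM sX Xg Xgx; rewrite mulVKg.
  - exact: order_exists (inverting_exp4 hinv ng).
  - exact: inverting_sqr hinv ng.
- by exists 1%N => // H _ []; apply: abelian_normal.
- exact: finite_ranks_BNI (inverting_gen sA cA genA A2 inv) r0 r2.
Qed.
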